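(* Let $\mathcal C$ be a Barr-exact category and let $F=(f_0,f_1)\colon \mathbb H\to\mathbb G$ be an internal functor between internal groupoids in $\mathcal C$. Then $F$ is final if and only if both of the following conditions hold: (i) $\pi_0(F)\colon\pi_0(\mathbb H)\to\pi_0(\mathbb G)$ is an isomorphism; (ii) the morphism $\psi_F\colon H_1\to \Sigma H_1\times_{\Sigma G_1}G_1$ induced by $\sigma_H\colon H_1\to\Sigma H_1$ and $f_1\colon H_1\to G_1$ is a regular epimorphism, where $\Sigma H_1\times_{\Sigma G_1}G_1$ denotes the pullback of $\sigma_G\colon G_1\to\Sigma G_1$ along $\Sigma f_1\colon\Sigma H_1\to\Sigma G_1$.
   Context: A Barr-exact category is a finitely complete regular category in which every internal equivalence relation is effective. An internal groupoid $\mathbb H$ in $\mathcal C$ has object of objects $H_0$, object of arrows $H_1$, domain and codomain $d,c\colon H_1\to H_0$, identities $e\colon H_0\to H_1$, composition $m\colon H_1\times_{(c,d)}H_1\to H_1$ (with $H_1\times_{(c,d)}H_1$ the pullback of $c$ along $d$) and inversion $i\colon H_1\to H_1$, satisfying the usual axioms. An internal functor $F\colon\mathbb H\to\mathbb G$ is a pair $F=(f_0,f_1)$ of morphisms $f_0\colon H_0\to G_0$, $f_1\colon H_1\to G_1$ compatible with $d,c,e,m$. $\mathsf{Gpd}(\mathcal C)$ is the category of internal groupoids and internal functors in $\mathcal C$. Discrete fibration: $F=(f_0,f_1)\colon\mathbb H\to\mathbb G$ is a discrete fibration if the commutative square $f_0\, c=c\, f_1$ exhibits $H_1$ as the pullback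 of $c\colon G_1\to G_0$ along $f_0\colon H_0\to G_0$. Final: $F$ is final if it is (left) orthogonal in $\mathsf{Gpd}(\mathcal C)$ to every discrete fibration, i.e. for every discrete fibration $K\colon\mathbb A\to\mathbb B$ and functors $U\colon\mathbb H\to\mathbb A$, $V\colon\mathbb G\to\mathbb B$ with $KU=VF$ there is a unique functor $D\colon\mathbb G\to\mathbb A$ with $DF=U$ and $KD=V$. Support and connected components: for a groupoid $\mathbb H$, factor $(d,c)\colon H_1\to H_0\times H_0$ as a regular epimorphism $\sigma_H\colon H_1\to\Sigma H_1$ followed by a monomorphism $(r_1,r_2)\colon\Sigma H_1\to H_0\times H_0$. This defines an equivalence relation $\Sigma\mathbb H$ on $H_0$ (the support of $\mathbb H$). Its quotient is denoted $q_H\colon H_0\to\pi_0(\mathbb H)$; it is also the coequalizer of $d,c\colon H_1\to H_0$. For a functor $F=(f_0,f_1)\colon\mathbb H\to\mathbb G$, $\Sigma f_1\colon\Sigma H_1\to\Sigma G_1$ is the unique morphism with $\Sigma f_1\cdot\sigma_H=\sigma_G\cdot f_1$ and $(r_1,r_2)\cdot\Sigma f_1=(f_0\times f_0)\cdot(r_1,r_2)$, and $\pi_0(F)$ is the unique morphism with $\pi_0(F)\,q_H=q_G\,f_0$. *)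

(* Defs.v *)
From Stdlib Require Import ProofIrrelevance.

Set Implicit Arguments.
Unset Strict Implicit.
Unset Printing Implicit Defensive.

Declare Scope cat_scope.
Local Open Scope cat_scope.

Record category := Category {
  ob :> Type;
  hom : ob -> ob -> Type;
  idm : forall X, hom X X;
  comp : forall X Y Z, hom Y Z -> hom X Y -> hom X Z;
  comp_idl : forall X Y (f : hom X Y), comp (idm Y) f = f;
  comp_idr : forall X Y (f : hom X Y), comp f (idm X) = f;
  comp_assoc : forall X Y Z W (h : hom Z W) (g : hom Y Z) (f : hom X Y),
    comp h (comp g f) = comp (comp h g) f
}.

Arguments idm {c} X.

Notation "X ~> Y" := (hom X Y) (at level 90, right associativity) : cat_scope.
Notation "g ∘ f" := (comp g f) (at level 40, left associativity) : cat_scope.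

Section Category.
Variable C : category.

Definition is_iso (X Y : C) (f : X ~> Y) : Prop :=
  exists g : Y ~> X, g ∘ f = idm X /\ f ∘ g = idm Y.

Definition is_mono (X Y : C) (f : X ~> Y) : Prop :=
  forall (W : C) (u v : W ~> X), f ∘ u = f ∘ v -> u = v.

Definition is_coequalizer (X Y Q : C) (u v : X ~> Y) (q : Y ~> Q) : Prop :=
  q ∘ u = q ∘ v /\
  forall (Z : C) (g : Y ~> Z), g ∘ u = g ∘ v -> exists! h : Q ~> Z, h ∘ q = g.

Definition regular_epi (Y Q : C) (q : Y ~> Q) : Prop :=
  exists (X : C) (u v : X ~> Y), is_coequalizer u v q.

Definition is_terminal (T : C) : Prop :=
  forall X : C, exists! _ : X ~> T, True.

Definition is_product (X Y P : C) (p1 : P ~> X) (p2 : P ~> Y) : Prop :=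
  forall (W : C) (u : W ~> X) (v : W ~> Y),
    exists! w : W ~> P, p1 ∘ w = u /\ p2 ∘ w = v.

Definition is_pullback (X Y Z P : C) (f : X ~> Z) (g : Y ~> Z)
    (p1 : P ~> X) (p2 : P ~> Y) : Prop :=
  f ∘ p1 = g ∘ p2 /\
  forall (W : C) (u : W ~> X) (v : W ~> Y), f ∘ u = g ∘ v ->
    exists! w : W ~> P, p1 ∘ w = u /\ p2 ∘ w = v.

Definition left_orthogonal (X Y A B : C) (f : X ~> Y) (k : A ~> B) : Prop :=
  forall (u : X ~> A) (v : Y ~> B), k ∘ u = v ∘ f ->
    exists! d : Y ~> A, d ∘ f = u /\ k ∘ d = v.

End Category.

Section Exact.
Variable C : category.

Definition finitely_complete : Prop :=
  (exists T : C, is_terminal T) /\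
  forall (X Y Z : C) (f : X ~> Z) (g : Y ~> Z),
    exists (P : C) (p1 : P ~> X) (p2 : P ~> Y), is_pullback f g p1 p2.

Definition regular_category : Prop :=
  finitely_complete /\
  (forall (X Y K : C) (f : X ~> Y) (k1 k2 : K ~> X), is_pullback f f k1 k2 ->
    exists (Q : C) (q : X ~> Q), is_coequalizer k1 k2 q) /\
  (forall (X Y Z P : C) (f : X ~> Z) (g : Y ~> Z) (p1 : P ~> X) (p2 : P ~> Y),
    is_pullback f g p1 p2 -> regular_epi g -> regular_epi p1).

Definition jointly_monic (X R : C) (r1 r2 : R ~> X) : Prop :=
  forall (W : C) (u v : W ~> R), r1 ∘ u = r1 ∘ v -> r2 ∘ u = r2 ∘ v -> u = v.

Definition equivalence_relation (X R : C) (r1 r2 : R ~> X) : Prop :=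
  jointly_monic r1 r2 /\
  (exists r : X ~> R, r1 ∘ r = idm X /\ r2 ∘ r = idm X) /\
  (exists s : R ~> R, r1 ∘ s = r2 /\ r2 ∘ s = r1) /\
  (forall (P : C) (p1 p2 : P ~> R), is_pullback r2 r1 p1 p2 ->
    exists t : P ~> R, r1 ∘ t = r1 ∘ p1 /\ r2 ∘ t = r2 ∘ p2).

Definition effective (X R : C) (r1 r2 : R ~> X) : Prop :=
  exists (Y : C) (f : X ~> Y), is_pullback f f r1 r2.

Definition barr_exact : Prop :=
  regular_category /\
  forall (X R : C) (r1 r2 : R ~> X), equivalence_relation r1 r2 -> effective r1 r2.

(** [g2] is the object of composable pairs: [(x, y)] with [c x = d y], composed
    by [gm] to "[x] followed by [y]".  The unit, associativity and inverse laws
    are written on (generalized) elements of [g2], described by their two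
    components; such elements exist and are unique by [g2_pullback]. *)
Record groupoid := Groupoid {
  g0 : C;
  g1 : C;
  gd : g1 ~> g0;
  gc : g1 ~> g0;
  ge : g0 ~> g1;
  g2 : C;
  gp1 : g2 ~> g1;
  gp2 : g2 ~> g1;
  g2_pullback : is_pullback gc gd gp1 gp2;
  gm : g2 ~> g1;
  gi : g1 ~> g1;
  gd_e : gd ∘ ge = idm g0;
  gc_e : gc ∘ ge = idm g0;
  gd_m : gd ∘ gm = gd ∘ gp1;
  gc_m : gc ∘ gm = gc ∘ gp2;
  gm_unitl : forall u : g1 ~> g2,
    gp1 ∘ u = ge ∘ gd -> gp2 ∘ u = idm g1 -> gm ∘ u = idm g1;
  gm_unitr : forall u : g1 ~> g2,
    gp1 ∘ u = idm g1 -> gp2 ∘ u = ge ∘ gc -> gm ∘ u = idm g1;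
  (* xy = (x, y), yz = (y, z), xy_z = (m (x, y), z), x_yz = (x, m (y, z)) *)
  gm_assoc : forall (W : C) (xy yz xy_z x_yz : W ~> g2),
    gp2 ∘ xy = gp1 ∘ yz ->
    gp1 ∘ xy_z = gm ∘ xy -> gp2 ∘ xy_z = gp2 ∘ yz ->
    gp1 ∘ x_yz = gp1 ∘ xy -> gp2 ∘ x_yz = gm ∘ yz ->
    gm ∘ xy_z = gm ∘ x_yz;
  gd_i : gd ∘ gi = gc;
  gc_i : gc ∘ gi = gd;
  gm_invr : forall u : g1 ~> g2,
    gp1 ∘ u = idm g1 -> gp2 ∘ u = gi -> gm ∘ u = ge ∘ gd;
  gm_invl : forall u : g1 ~> g2,
    gp1 ∘ u = gi -> gp2 ∘ u = idm g1 -> gm ∘ u = ge ∘ gc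
}.

(** In [f_m], [u] is the morphism induced by [f1] on composable pairs. *)
Record functor (H G : groupoid) := Functor {
  f0 : g0 H ~> g0 G;
  f1 : g1 H ~> g1 G;
  f_d : gd G ∘ f1 = f0 ∘ gd H;
  f_c : gc G ∘ f1 = f0 ∘ gc H;
  f_e : f1 ∘ ge H = ge G ∘ f0;
  f_m : forall u : g2 H ~> g2 G,
    gp1 G ∘ u = f1 ∘ gp1 H -> gp2 G ∘ u = f1 ∘ gp2 H ->
    f1 ∘ gm H = gm G ∘ u
}.

Lemma functor_ext (H G : groupoid) (F F' : functor H G) :
  f0 F = f0 F' -> f1 F = f1 F' -> F = F'.
Proof.
destruct F as [a b h1 h2 h3 h4], F' as [a' b' h1' h2' h3' h4']; cbn.
intros <- <-.
rewrite (proof_irrelevance _ h1' h1), (proof_irrelevance _ h2' h2),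
  (proof_irrelevance _ h3' h3), (proof_irrelevance _ h4' h4).
reflexivity.
Qed.

Lemma functor_id_m (H : groupoid) (u : g2 H ~> g2 H) :
  gp1 H ∘ u = idm _ ∘ gp1 H -> gp2 H ∘ u = idm _ ∘ gp2 H ->
  idm _ ∘ gm H = gm H ∘ u.
Proof.
rewrite !comp_idl; intros e1 e2.
destruct (g2_pullback H) as [sq U].
destruct (U _ _ _ sq) as [w [_ Hw]].
rewrite <- (Hw u (conj e1 e2)).
rewrite (Hw (idm _) (conj (comp_idr _) (comp_idr _))).
now rewrite comp_idr.
Qed.

Definition functor_id (H : groupoid) : functor H H.
Proof.
refine (@Functor H H (idm _) (idm _) _ _ _ (@functor_id_m H));
  now rewrite comp_idl, comp_idr.
Defined.

Lemma functor_comp_m (H G K : groupoid) (E : functor G K) (F : functor H G)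
    (u : g2 H ~> g2 K) :
  gp1 K ∘ u = f1 E ∘ f1 F ∘ gp1 H -> gp2 K ∘ u = f1 E ∘ f1 F ∘ gp2 H ->
  f1 E ∘ f1 F ∘ gm H = gm K ∘ u.
Proof.
intros e1 e2.
destruct (g2_pullback G) as [sqG UG], (g2_pullback H) as [sqH _],
  (g2_pullback K) as [sqK UK].
destruct (UG _ (f1 F ∘ gp1 H) (f1 F ∘ gp2 H)) as [v [[v1 v2] _]].
{ now rewrite !comp_assoc, f_c, f_d, <- !comp_assoc, sqH. }
destruct (UK _ (f1 E ∘ gp1 G) (f1 E ∘ gp2 G)) as [w [[w1 w2] _]].
{ now rewrite !comp_assoc, f_c, f_d, <- !comp_assoc, sqG. }
rewrite <- comp_assoc, (f_m v1 v2), comp_assoc, (f_m w1 w2), <- comp_assoc.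
f_equal.
destruct (UK _ (gp1 K ∘ u) (gp2 K ∘ u)) as [z [_ Hz]].
{ now rewrite !comp_assoc, sqK. }
rewrite <- (Hz u (conj eq_refl eq_refl)); symmetry; apply Hz.
rewrite !comp_assoc, w1, w2, e1, e2, <- !comp_assoc, v1, v2; split; reflexivity.
Qed.

Definition functor_comp (H G K : groupoid) (E : functor G K) (F : functor H G) :
  functor H K.
Proof.
refine (@Functor H K (f0 E ∘ f0 F) (f1 E ∘ f1 F) _ _ _ (@functor_comp_m H G K E F)).
- now rewrite comp_assoc, f_d, <- comp_assoc, f_d, comp_assoc.
- now rewrite comp_assoc, f_c, <- comp_assoc, f_c, comp_assoc.
- now rewrite <- comp_assoc, f_e, comp_assoc, f_e, comp_assoc.
Defined.

Definition Gpd : category.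
Proof.
refine (@Category groupoid functor functor_id functor_comp _ _ _);
  intros; apply functor_ext; cbn;
  first [apply comp_idl | apply comp_idr | apply comp_assoc].
Defined.

Definition discrete_fibration (H G : groupoid) (F : functor H G) : Prop :=
  is_pullback (f0 F) (gc G) (gc H) (f1 F).

Definition final (H G : groupoid) (F : functor H G) : Prop :=
  forall (A B : groupoid) (K : functor A B), discrete_fibration K ->
    @left_orthogonal Gpd H G A B F K.

(** Any choice of the product [g0 H * g0 H] and of the (regular epi, mono)
    factorization of [(d, c)]. *)
Record support (H : groupoid) := Support {
  sprod : C;
  spr1 : sprod ~> g0 H;
  spr2 : sprod ~> g0 H;
  sprod_product : is_product spr1 spr2;
  sob : C;
  sigma : g1 H ~> sob;
  sr : sob ~> sprod;
  sigma_regular_epi : regular_epi sigma;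
  sr_mono : is_mono sr;
  sr_sigma_d : spr1 ∘ (sr ∘ sigma) = gd H;
  sr_sigma_c : spr2 ∘ (sr ∘ sigma) = gc H
}.

Definition sr1 (H : groupoid) (S : support H) : sob S ~> g0 H := spr1 S ∘ sr S.
Definition sr2 (H : groupoid) (S : support H) : sob S ~> g0 H := spr2 S ∘ sr S.

Record components (H : groupoid) (S : support H) := Components {
  pi0 : C;
  pi0_q : g0 H ~> pi0;
  pi0_q_coequalizer : is_coequalizer (sr1 S) (sr2 S) pi0_q
}.

Definition is_support_map (H G : groupoid) (F : functor H G)
    (SH : support H) (SG : support G) (s : sob SH ~> sob SG) : Prop :=
  s ∘ sigma SH = sigma SG ∘ f1 F /\
  sr1 SG ∘ s = f0 F ∘ sr1 SH /\
  sr2 SG ∘ s = f0 F ∘ sr2 SH.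

Definition is_pi0_map (H G : groupoid) (F : functor H G)
    (SH : support H) (SG : support G) (QH : components SH) (QG : components SG)
    (p : pi0 QH ~> pi0 QG) : Prop :=
  p ∘ pi0_q QH = pi0_q QG ∘ f0 F.

(** The lemmas below show that the choices made in [support] and [components]
    are possible in a Barr-exact category, and that the morphisms specified by
    [is_support_map] and [is_pi0_map] exist and are unique. *)

Lemma regular_epi_epi (X Y Z : C) (q : X ~> Y) (a b : Y ~> Z) :
  regular_epi q -> a ∘ q = b ∘ q -> a = b.
Proof.
intros [W [u [v [e U]]]] h.
destruct (U _ (a ∘ q)) as [w [_ Hw]].
{ now rewrite <- !comp_assoc, e. }
rewrite <- (Hw a eq_refl); now apply Hw.
Qed.

Lemma regular_epi_lift (A B R X : C) (p : A ~> B) (r1 r2 : R ~> X)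
    (u : A ~> R) (v1 v2 : B ~> X) :
  regular_epi p -> jointly_monic r1 r2 ->
  r1 ∘ u = v1 ∘ p -> r2 ∘ u = v2 ∘ p ->
  exists w : B ~> R, w ∘ p = u /\ r1 ∘ w = v1 /\ r2 ∘ w = v2.
Proof.
intros hp hr h1 h2.
pose proof hp as [W [a [b [e U]]]].
destruct (U _ u) as [w [Hw _]].
{ apply hr; rewrite !comp_assoc, ?h1, ?h2, <- !comp_assoc; now rewrite e. }
exists w; split; [exact Hw|].
split; apply (regular_epi_epi hp); now rewrite <- comp_assoc, Hw.
Qed.

Lemma product_exists (X Y : C) : finitely_complete ->
  exists (P : C) (p1 : P ~> X) (p2 : P ~> Y), is_product p1 p2.
Proof.
intros [[T hT] pb].
destruct (hT X) as [tX _], (hT Y) as [tY _].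
destruct (pb _ _ _ tX tY) as [P [p1 [p2 [_ U]]]].
exists P, p1, p2; intros W u v; apply U.
destruct (hT W) as [t [_ Ht]].
now rewrite <- (Ht (tX ∘ u) I); apply Ht.
Qed.

Lemma image_factorization (X Y : C) (f : X ~> Y) : regular_category ->
  exists (I : C) (p : X ~> I) (m : I ~> Y),
    regular_epi p /\ is_mono m /\ m ∘ p = f.
Proof.
intros [[_ pb] [ck st]].
destruct (pb _ _ _ f f) as [K [k1 [k2 hK]]].
destruct (ck _ _ _ _ _ _ hK) as [I [p hp]].
assert (rp : regular_epi p) by now exists K, k1, k2.
pose proof hp as [ep Up]; destruct hK as [eK UK].
destruct (Up _ f eK) as [m [Hm _]].
exists I, p, m; split; [exact rp|split; [|exact Hm]].
intros W a b hab.
destruct (pb _ _ _ a p) as [P1 [p1 [x1 h1]]].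
pose proof (st _ _ _ _ _ _ _ _ h1 rp) as rp1; destruct h1 as [e1 _].
destruct (pb _ _ _ (b ∘ p1) p) as [P2 [p2 [x2 h2]]].
pose proof (st _ _ _ _ _ _ _ _ h2 rp) as rp2; destruct h2 as [e2 _].
apply (regular_epi_epi rp1), (regular_epi_epi rp2).
rewrite e1, e2.
destruct (UK _ (x1 ∘ p2) x2) as [z [[z1 z2] _]].
{ rewrite <- Hm, <- comp_assoc, (comp_assoc p), <- e1, <- (comp_assoc m), <- e2.
  now rewrite !comp_assoc, hab. }
now rewrite <- comp_assoc, <- z1, <- z2, !comp_assoc, ep.
Qed.

Lemma support_exists (H : groupoid) : regular_category -> inhabited (support H).
Proof.
intros hC.
destruct (product_exists (g0 H) (g0 H) (proj1 hC)) as [P [p1 [p2 hP]]].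
destruct (hP _ (gd H) (gc H)) as [dc [[e1 e2] _]].
destruct (image_factorization dc hC) as [I [p [m [hp [hm e]]]]].
constructor.
refine (@Support H P p1 p2 hP I p m hp hm _ _); now rewrite e.
Qed.

Section Support.
Variables (H : groupoid) (S : support H).

Lemma sr1_sigma : sr1 S ∘ sigma S = gd H.
Proof. unfold sr1; rewrite <- comp_assoc; apply sr_sigma_d. Qed.

Lemma sr2_sigma : sr2 S ∘ sigma S = gc H.
Proof. unfold sr2; rewrite <- comp_assoc; apply sr_sigma_c. Qed.

Lemma sr_jointly_monic : jointly_monic (sr1 S) (sr2 S).
Proof.
intros W u v; unfold sr1, sr2; rewrite <- !comp_assoc; intros e1 e2.
apply (sr_mono (s := S)).
destruct (sprod_product S (spr1 S ∘ (sr S ∘ u)) (spr2 S ∘ (sr S ∘ u)))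
  as [w [_ Hw]].
rewrite <- (Hw (sr S ∘ u)); [apply Hw|]; now split.
Qed.

Lemma support_equivalence :
  regular_category -> equivalence_relation (sr1 S) (sr2 S).
Proof.
intros [[_ pb] [_ st]].
pose proof (sigma_regular_epi S) as rs.
pose proof sr_jointly_monic as jm.
split; [exact jm|split; [|split]].
- exists (sigma S ∘ ge H).
  now rewrite !comp_assoc, sr1_sigma, sr2_sigma, gd_e, gc_e.
- destruct (@regular_epi_lift _ _ _ _ (sigma S) (sr1 S) (sr2 S)
    (sigma S ∘ gi H) (sr2 S) (sr1 S) rs jm) as [s [_ hs]].
  + now rewrite comp_assoc, sr1_sigma, gd_i, sr2_sigma.
  + now rewrite comp_assoc, sr2_sigma, gc_i, sr1_sigma.
  + now exists s.
- intros P p1 p2 [eP _].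
  destruct (pb _ _ _ p1 (sigma S)) as [P1 [a [x h1]]].
  pose proof (st _ _ _ _ _ _ _ _ h1 rs) as ra; destruct h1 as [e1 _].
  destruct (pb _ _ _ (p2 ∘ a) (sigma S)) as [P2 [b [y h2]]].
  pose proof (st _ _ _ _ _ _ _ _ h2 rs) as rb; destruct h2 as [e2 _].
  destruct (g2_pullback H) as [_ U].
  destruct (U _ (x ∘ b) y) as [z [[z1 z2] _]].
  { rewrite <- sr1_sigma, <- sr2_sigma, <- (comp_assoc (sr1 S)), <- e2.
    rewrite comp_assoc, <- (comp_assoc (sr2 S)), <- e1, !comp_assoc.
    now rewrite eP. }
  destruct (@regular_epi_lift _ _ _ _ b (sr1 S) (sr2 S)
    (sigma S ∘ (gm H ∘ z)) (sr1 S ∘ p1 ∘ a) (sr2 S ∘ p2 ∘ a) rb jm)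
    as [w [_ [w1 w2]]].
  + rewrite comp_assoc, sr1_sigma, comp_assoc, gd_m, <- comp_assoc, z1.
    rewrite <- sr1_sigma, <- (comp_assoc (sr1 S)), (comp_assoc (sigma S)), <- e1.
    now rewrite !comp_assoc.
  + rewrite comp_assoc, sr2_sigma, comp_assoc, gc_m, <- comp_assoc, z2.
    rewrite <- sr2_sigma, <- (comp_assoc (sr2 S)), <- e2.
    now rewrite !comp_assoc.
  + destruct (@regular_epi_lift _ _ _ _ a (sr1 S) (sr2 S) w
      (sr1 S ∘ p1) (sr2 S ∘ p2) ra jm w1 w2) as [t [_ ht]].
    now exists t.
Qed.

Lemma components_exist : barr_exact -> inhabited (components S).
Proof.
intros [hC ex].
destruct (ex _ _ _ _ (support_equivalence hC)) as [Y [f hf]].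
destruct hC as [_ [ck _]].
destruct (ck _ _ _ _ _ _ hf) as [Q [q hq]].
now constructor; exists Q q.
Qed.

End Support.

Lemma support_map_exists (H G : groupoid) (F : functor H G)
    (SH : support H) (SG : support G) :
  exists! s : sob SH ~> sob SG, is_support_map F s.
Proof.
destruct (@regular_epi_lift _ _ _ _ (sigma SH) (sr1 SG) (sr2 SG)
  (sigma SG ∘ f1 F) (f0 F ∘ sr1 SH) (f0 F ∘ sr2 SH)
  (sigma_regular_epi SH) (@sr_jointly_monic _ SG)) as [s [hs hs']].
- now rewrite comp_assoc, sr1_sigma, <- comp_assoc, sr1_sigma, f_d.
- now rewrite comp_assoc, sr2_sigma, <- comp_assoc, sr2_sigma, f_c.
- exists s; split; [now split|].
  intros t [ht _]; apply (regular_epi_epi (sigma_regular_epi SH)).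
  now rewrite hs, ht.
Qed.

Lemma pi0_map_exists (H G : groupoid) (F : functor H G)
    (SH : support H) (SG : support G) (QH : components SH) (QG : components SG) :
  exists! p : pi0 QH ~> pi0 QG, is_pi0_map F p.
Proof.
destruct (support_map_exists F SH SG) as [s [[_ [h1 h2]] _]].
apply (pi0_q_coequalizer QH).
rewrite <- !comp_assoc, <- h1, <- h2, !comp_assoc.
now rewrite (proj1 (pi0_q_coequalizer QG)).
Qed.

End Exact.

(* Main.v *)
(** Both sides are equivalent to a local form of "essentially surjective and
    full": every [y : W -> G0] admits, after a regular epimorphism onto [W], an
    arrow [y -> f0 x], and every [g : f0 x -> f0 x'] is, after a regular
    epimorphism, of the form [f1 h] with [h : x -> x'].

    If this holds, the diagonal of a square against a discrete fibration sends
    [y] to the restriction of [u0 x] along [v1 g], for any local [g : y -> f0 x];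
    fullness makes this independent of [g], so that it descends along
    [G1 x_(G0) H0 -> G0].  Conversely, the connected components of the pairs
    [(x, g : y -> f0 x)] form a discrete fibration over [G] by exactness; [F]
    lifts to it, and finality extends the lift to a section.  The value of the
    section at [y] gives a local arrow [y -> f0 x], and its value at
    [g : f0 x -> f0 x'] shows that [(x, id)] and [(x, g)] are connected, which is
    fullness.  The link with the conditions of the theorem is that [Sigma H] is
    the kernel pair of [q_H]. *)
From Stdlib Require Import ClassicalEpsilon.
Require Import Defs.

Set Implicit Arguments.
Unset Strict Implicit.
Unset Printing Implicit Defensive.

Local Open Scope cat_scope.

(** * Generalized elements of a pullback *)

Section Pullback.
Variable C : category.

Lemma comp_pre (X Y Z W : C) (g : Y ~> Z) (f : X ~> Y) (k : X ~> Z) (w : W ~> X) :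
  g ∘ f = k -> g ∘ (f ∘ w) = k ∘ w.
Proof. now intros <-; rewrite comp_assoc. Qed.

Lemma comp_pre2 (X Y Y' Z W : C) (g : Y ~> Z) (f : X ~> Y) (g' : Y' ~> Z)
    (f' : X ~> Y') (w : W ~> X) :
  g ∘ f = g' ∘ f' -> g ∘ (f ∘ w) = g' ∘ (f' ∘ w).
Proof. now intros e; rewrite !comp_assoc, e. Qed.

Variables (X Y Z P : C) (f : X ~> Z) (g : Y ~> Z) (p1 : P ~> X) (p2 : P ~> Y).
Hypothesis hP : is_pullback f g p1 p2.

Lemma pb_square W (w : W ~> P) : f ∘ (p1 ∘ w) = g ∘ (p2 ∘ w).
Proof. apply comp_pre2, hP. Qed.

Lemma pb_ext W (u v : W ~> P) : p1 ∘ u = p1 ∘ v -> p2 ∘ u = p2 ∘ v -> u = v.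
Proof.
intros e1 e2; destruct (proj2 hP W (p1 ∘ v) (p2 ∘ v) (pb_square v)) as [w [_ Hw]].
now rewrite <- (Hw u (conj e1 e2)); apply Hw.
Qed.

(** The universal property is only a proposition; unique choice makes it an operation, from which
    structure maps of groupoids can be built. *)
Definition pb_pair W (u : W ~> X) (v : W ~> Y) (e : f ∘ u = g ∘ v) : W ~> P :=
  proj1_sig (constructive_definite_description _ (proj2 hP W u v e)).

Lemma pb_pair1 W (u : W ~> X) (v : W ~> Y) (e : f ∘ u = g ∘ v) :
  p1 ∘ pb_pair e = u.
Proof. unfold pb_pair; now destruct constructive_definite_description. Qed.

Lemma pb_pair2 W (u : W ~> X) (v : W ~> Y) (e : f ∘ u = g ∘ v) :
  p2 ∘ pb_pair e = v.
Proof. unfold pb_pair; now destruct constructive_definite_description. Qed.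

Lemma pb_lift W (u : W ~> X) (v : W ~> Y) :
  f ∘ u = g ∘ v -> exists w : W ~> P, p1 ∘ w = u /\ p2 ∘ w = v.
Proof. intros e; exists (pb_pair e); split; [apply pb_pair1|apply pb_pair2]. Qed.

End Pullback.

(** * Regular epimorphisms as covers: local lifting and descent *)

Section Regular.
Variable C : category.
Hypothesis hC : regular_category C.

(** In a regular category the regular epimorphisms are the extremal ones. *)
Lemma regular_epi_extremal (X Y : C) (q : X ~> Y) :
  regular_epi q <->
  forall (M : C) (m : M ~> Y) (u : X ~> M), is_mono m -> m ∘ u = q ->
    exists s : Y ~> M, m ∘ s = idm Y.
Proof.
split.
- intros [K [a [b [e U]]]] M m u hm hu.
  destruct (U _ u) as [s [hs _]].
  { apply hm; now rewrite !comp_assoc, hu. }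
  exists s; apply (@regular_epi_epi C _ _ _ q); [now exists K, a, b|].
  now rewrite <- comp_assoc, hs, hu, comp_idl.
- intros ext; destruct (image_factorization q hC) as [I [p [m [hp [hm e]]]]].
  destruct (ext _ m p hm e) as [s hs].
  destruct hp as [K [a [b [ep U]]]]; exists K, a, b; split.
  + now rewrite <- e, <- !comp_assoc, ep.
  + intros Z g hg; destruct (U _ g hg) as [h [hh Hh]].
    assert (sm : s ∘ m = idm I).
    { apply hm; now rewrite comp_assoc, hs, comp_idl, comp_idr. }
    exists (h ∘ s); split.
    * rewrite <- e, <- comp_assoc, (comp_assoc s), sm, comp_idl; exact hh.
    * intros h' hh'; rewrite (Hh (h' ∘ m)).
      { now rewrite <- comp_assoc, hs, comp_idr. }
      now rewrite <- comp_assoc, e.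
Qed.

(** By extremality: pull a monomorphism [m] through which [g ∘ f] factors back along [g]. The
    pullback splits because [f] is extremal, so [g] factors through [m], which then splits as
    well. *)
Lemma regular_epi_comp (X Y Z : C) (f : X ~> Y) (g : Y ~> Z) :
  regular_epi f -> regular_epi g -> regular_epi (g ∘ f).
Proof.
rewrite !regular_epi_extremal; intros hf hg M m u hm hu.
destruct (proj2 (proj1 hC) _ _ _ g m) as [P [p1 [p2 hP]]].
destruct (pb_lift hP (eq_sym hu)) as [w [hw _]].
destruct (hf _ p1 w) as [s hs]; [|exact hw|].
- intros W a b e; apply (pb_ext hP); [exact e|].
  apply hm; now rewrite <- !(pb_square hP), e.
- apply (hg _ m (p2 ∘ s) hm).
  now rewrite <- (pb_square hP), hs, comp_idr.
Qed.

Lemma regular_epi_cancel (X Y Z : C) (f : X ~> Y) (g : Y ~> Z) :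
  regular_epi (g ∘ f) -> regular_epi g.
Proof.
rewrite !regular_epi_extremal; intros hgf M m u hm hu.
apply (hgf _ m (u ∘ f) hm); now rewrite comp_assoc, hu.
Qed.

Lemma regular_epi_mono_iso (X Y : C) (f : X ~> Y) :
  regular_epi f -> is_mono f -> is_iso f.
Proof.
rewrite regular_epi_extremal; intros hf hm.
destruct (hf _ f (idm X) hm (comp_idr f)) as [s hs].
exists s; split; [|exact hs].
apply hm; now rewrite comp_assoc, hs, comp_idl, comp_idr.
Qed.

(** Stability under pullback lets a regular epimorphism be treated as a surjection: elements lift
    after passing to a cover. *)
Lemma local_section (X Y W : C) (q : X ~> Y) (y : W ~> Y) : regular_epi q ->
  exists (W' : C) (e : W' ~> W) (x : W' ~> X), regular_epi e /\ q ∘ x = y ∘ e.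
Proof.
intros hq; destruct (proj2 (proj1 hC) _ _ _ y q) as [P [p1 [p2 hP]]].
exists P, p1, p2; split; [|now rewrite (proj1 hP)].
exact (proj2 (proj2 hC) _ _ _ _ _ _ _ _ hP hq).
Qed.

Lemma regular_epi_local (X Y W : C) (q : X ~> Y) (e : W ~> Y) (x : W ~> X) :
  regular_epi e -> q ∘ x = e -> regular_epi q.
Proof. intros he hx; apply (@regular_epi_cancel _ _ _ x); now rewrite hx. Qed.

(** The pair coequalized by [q] is one instance of the hypothesis; quantifying over all pairs allows
    arguments on elements. *)
Lemma regular_epi_descent (X Y Z : C) (q : X ~> Y) (f : X ~> Z) :
  regular_epi q ->
  (forall W (a b : W ~> X), q ∘ a = q ∘ b -> f ∘ a = f ∘ b) ->
  exists h : Y ~> Z, h ∘ q = f.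
Proof.
intros [K [a [b [e U]]]] hf.
destruct (U _ f (hf _ _ _ e)) as [h [hh _]]; now exists h.
Qed.

End Regular.

(** * Groupoid algebra on generalized arrows *)

Section Calculus.
Variables (C : category) (G : groupoid C).
Implicit Types W : C.

(** Composition of generalized arrows, "[a] followed by [b]"; the junk value
    when they are not composable is [a]. *)
Definition mul W (a b : W ~> g1 G) : W ~> g1 G :=
  match excluded_middle_informative (gc G ∘ a = gd G ∘ b) with
  | left e => gm G ∘ pb_pair (g2_pullback G) e
  | right _ => a
  end.

Definition inv_at W (a : W ~> g1 G) : W ~> g1 G := gi G ∘ a.
Definition unit_at W (x : W ~> g0 G) : W ~> g1 G := ge G ∘ x.

Lemma mulE W (a b : W ~> g1 G) (z : W ~> g2 G) :
  gp1 G ∘ z = a -> gp2 G ∘ z = b -> mul a b = gm G ∘ z.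
Proof.
intros <- <-; unfold mul; destruct excluded_middle_informative as [e|ne].
- f_equal; apply (pb_ext (g2_pullback G)); [apply pb_pair1|apply pb_pair2].
- destruct ne; apply (pb_square (g2_pullback G)).
Qed.

Lemma composable W (a b : W ~> g1 G) : gc G ∘ a = gd G ∘ b ->
  exists z : W ~> g2 G, gp1 G ∘ z = a /\ gp2 G ∘ z = b /\ mul a b = gm G ∘ z.
Proof.
intros e; destruct (pb_lift (g2_pullback G) e) as [z [h1 h2]].
exists z; auto using mulE.
Qed.

Lemma d_mul W (a b : W ~> g1 G) : gc G ∘ a = gd G ∘ b -> gd G ∘ mul a b = gd G ∘ a.
Proof.
intros h; destruct (composable h) as [z [h1 [h2 ->]]].
rewrite <- h1; apply comp_pre2, gd_m.
Qed.

Lemma c_mul W (a b : W ~> g1 G) : gc G ∘ a = gd G ∘ b -> gc G ∘ mul a b = gc G ∘ b.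
Proof.
intros h; destruct (composable h) as [z [h1 [h2 ->]]].
rewrite <- h2; apply comp_pre2, gc_m.
Qed.

Lemma mul_comp W W' (a b : W ~> g1 G) (w : W' ~> W) :
  gc G ∘ a = gd G ∘ b -> mul a b ∘ w = mul (a ∘ w) (b ∘ w).
Proof.
intros h; destruct (composable h) as [z [h1 [h2 ->]]].
rewrite (@mulE _ (a ∘ w) (b ∘ w) (z ∘ w)); rewrite comp_assoc; congruence.
Qed.

Lemma d_inv W (a : W ~> g1 G) : gd G ∘ inv_at a = gc G ∘ a.
Proof. apply comp_pre, gd_i. Qed.

Lemma c_inv W (a : W ~> g1 G) : gc G ∘ inv_at a = gd G ∘ a.
Proof. apply comp_pre, gc_i. Qed.

Lemma d_unit W (x : W ~> g0 G) : gd G ∘ unit_at x = x.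
Proof. unfold unit_at; rewrite comp_assoc, gd_e; apply comp_idl. Qed.

Lemma c_unit W (x : W ~> g0 G) : gc G ∘ unit_at x = x.
Proof. unfold unit_at; rewrite comp_assoc, gc_e; apply comp_idl. Qed.

Lemma inv_comp W W' (a : W ~> g1 G) (w : W' ~> W) : inv_at a ∘ w = inv_at (a ∘ w).
Proof. symmetry; apply comp_assoc. Qed.

Lemma unit_comp W W' (x : W ~> g0 G) (w : W' ~> W) : unit_at x ∘ w = unit_at (x ∘ w).
Proof. symmetry; apply comp_assoc. Qed.

(** The unit and inverse laws of a groupoid are given at the universal arrow [idm (g1 G)];
    naturality of [mul] carries them to every stage. *)
Lemma mul_idm (f g h : g1 G ~> g1 G) : gc G ∘ f = gd G ∘ g ->
  (forall u : g1 G ~> g2 G, gp1 G ∘ u = f -> gp2 G ∘ u = g -> gm G ∘ u = h) ->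
  forall W (a : W ~> g1 G), mul (f ∘ a) (g ∘ a) = h ∘ a.
Proof.
intros e k W a; rewrite <- mul_comp by exact e.
destruct (composable e) as [z [h1 [h2 ->]]]; now rewrite k.
Qed.

Lemma mul_unit_l W (a : W ~> g1 G) x : x = gd G ∘ a -> mul (unit_at x) a = a.
Proof.
intros ->.
pose proof (@mul_idm (ge G ∘ gd G) (idm _) (idm _)) as h.
rewrite comp_idr, comp_assoc, gc_e, comp_idl in h.
specialize (h eq_refl (@gm_unitl _ G) W a); rewrite !comp_idl in h.
now unfold unit_at; rewrite comp_assoc.
Qed.

Lemma mul_unit_r W (a : W ~> g1 G) x : x = gc G ∘ a -> mul a (unit_at x) = a.
Proof.
intros ->.
pose proof (@mul_idm (idm _) (ge G ∘ gc G) (idm _)) as h.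
rewrite comp_idr, comp_assoc, gd_e, comp_idl in h.
specialize (h eq_refl (@gm_unitr _ G) W a); rewrite !comp_idl in h.
now unfold unit_at; rewrite comp_assoc.
Qed.

Lemma mul_inv_r W (a : W ~> g1 G) : mul a (inv_at a) = unit_at (gd G ∘ a).
Proof.
pose proof (@mul_idm (idm _) (gi G) (ge G ∘ gd G)) as h.
rewrite comp_idr, gd_i in h.
specialize (h eq_refl (@gm_invr _ G) W a); rewrite comp_idl in h.
now unfold unit_at, inv_at; rewrite comp_assoc.
Qed.

Lemma mul_inv_l W (a : W ~> g1 G) : mul (inv_at a) a = unit_at (gc G ∘ a).
Proof.
pose proof (@mul_idm (gi G) (idm _) (ge G ∘ gc G)) as h.
rewrite comp_idr, gc_i in h.
specialize (h eq_refl (@gm_invl _ G) W a); rewrite comp_idl in h.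
now unfold unit_at, inv_at; rewrite comp_assoc.
Qed.

Lemma mul_assoc W (a b c : W ~> g1 G) :
  gc G ∘ a = gd G ∘ b -> gc G ∘ b = gd G ∘ c ->
  mul (mul a b) c = mul a (mul b c).
Proof.
intros e1 e2.
destruct (composable e1) as [ab [h1 [h2 h3]]], (composable e2) as [bc [h4 [h5 h6]]].
destruct (@composable _ (mul a b) c) as [ab_c [h7 [h8 ->]]].
{ now rewrite c_mul. }
destruct (@composable _ a (mul b c)) as [a_bc [h9 [h10 ->]]].
{ now rewrite d_mul. }
apply (@gm_assoc _ G _ ab bc); congruence.
Qed.

Lemma mul_inv_cancel_l W (a b : W ~> g1 G) :
  gc G ∘ a = gd G ∘ b -> mul (inv_at a) (mul a b) = b.
Proof.
intros e; rewrite <- mul_assoc, mul_inv_l by (rewrite ?c_inv; auto).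
now apply mul_unit_l.
Qed.

Lemma mul_cancel_inv_l W (a b : W ~> g1 G) :
  gd G ∘ a = gd G ∘ b -> mul a (mul (inv_at a) b) = b.
Proof.
intros e; rewrite <- mul_assoc, mul_inv_r by (rewrite ?d_inv, ?c_inv; auto).
now apply mul_unit_l.
Qed.

Lemma mul_cancel_inv_r W (a b : W ~> g1 G) :
  gc G ∘ a = gc G ∘ b -> mul (mul a (inv_at b)) b = a.
Proof.
intros e; rewrite mul_assoc, mul_inv_l by (rewrite ?d_inv, ?c_inv; auto).
now apply mul_unit_r.
Qed.

Lemma mul_cancel_r W (a b : W ~> g1 G) :
  gc G ∘ a = gd G ∘ b -> mul (mul a b) (inv_at b) = a.
Proof.
intros e; rewrite mul_assoc, mul_inv_r by (rewrite ?d_inv, ?c_inv; auto).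
now apply mul_unit_r.
Qed.

Lemma inv_unit W (x : W ~> g0 G) : inv_at (unit_at x) = unit_at x.
Proof.
rewrite <- (@mul_unit_l _ (inv_at (unit_at x)) x) by now rewrite d_inv, c_unit.
now rewrite mul_inv_r, d_unit.
Qed.

Lemma inv_mul W (a b : W ~> g1 G) :
  gc G ∘ a = gd G ∘ b -> inv_at (mul a b) = mul (inv_at b) (inv_at a).
Proof.
intros e.
assert (e' : gc G ∘ inv_at b = gd G ∘ inv_at a) by now rewrite c_inv, d_inv.
(* The right-hand side is multiplied on the left by [mul a b] and its inverse; then [mul a b]
   cancels against it, leaving a unit. *)
rewrite <- (@mul_inv_cancel_l _ (mul a b) (mul (inv_at b) (inv_at a))).
- rewrite mul_assoc, mul_cancel_inv_l, mul_inv_r;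
    rewrite ?d_mul, ?d_inv by assumption; auto.
  symmetry; apply mul_unit_r; now rewrite c_inv, d_mul.
- now rewrite c_mul, d_mul, d_inv.
Qed.

End Calculus.

(** * Internal functors on generalized arrows *)

Section Functor.
Variables (C : category) (H G : groupoid C).

Section Preservation.
Variable F : functor H G.
Implicit Types W : C.

Lemma f_d_at W (a : W ~> g1 H) : gd G ∘ (f1 F ∘ a) = f0 F ∘ (gd H ∘ a).
Proof. apply comp_pre2, f_d. Qed.

Lemma f_c_at W (a : W ~> g1 H) : gc G ∘ (f1 F ∘ a) = f0 F ∘ (gc H ∘ a).
Proof. apply comp_pre2, f_c. Qed.

Lemma f_unit W (x : W ~> g0 H) : f1 F ∘ unit_at x = unit_at (f0 F ∘ x).
Proof. apply comp_pre2, f_e. Qed.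

Lemma f_mul W (a b : W ~> g1 H) :
  gc H ∘ a = gd H ∘ b -> f1 F ∘ mul a b = mul (f1 F ∘ a) (f1 F ∘ b).
Proof.
intros e; destruct (composable e) as [z [h1 [h2 ->]]].
destruct (@pb_lift _ _ _ _ _ _ _ _ _ (g2_pullback G) _ (f1 F ∘ gp1 H) (f1 F ∘ gp2 H))
  as [u [u1 u2]].
{ now rewrite f_c_at, f_d_at, (proj1 (g2_pullback H)). }
rewrite (@mulE _ _ _ _ _ (u ∘ z)).
- rewrite !comp_assoc; f_equal; now apply f_m.
- rewrite <- h1, !comp_assoc; congruence.
- rewrite <- h2, !comp_assoc; congruence.
Qed.

End Preservation.

(** Preservation of composites at all stages yields [f_m] at the universal composable pair
    [(gp1, gp2)], whose composite is [gm]. *)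
Lemma functor_intro (h0 : g0 H ~> g0 G) (h1 : g1 H ~> g1 G) :
  gd G ∘ h1 = h0 ∘ gd H -> gc G ∘ h1 = h0 ∘ gc H -> h1 ∘ ge H = ge G ∘ h0 ->
  (forall W (a b : W ~> g1 H), gc H ∘ a = gd H ∘ b ->
    h1 ∘ mul a b = mul (h1 ∘ a) (h1 ∘ b)) ->
  exists F : functor H G, f0 F = h0 /\ f1 F = h1.
Proof.
intros e1 e2 e3 hm.
unshelve eexists (@Functor C H G h0 h1 e1 e2 e3 _); [|now split].
intros u u1 u2.
rewrite <- (mulE u1 u2), <- hm by apply g2_pullback.
now rewrite (@mulE _ _ _ _ _ (idm _)), comp_idr by apply comp_idr.
Qed.

End Functor.

(** Arrows of [A] are determined by their codomain and their image under [K], so preservation of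
    units and composites is inherited from [V]. *)
Lemma discrete_fibration_functor (C : category) (H A B : groupoid C)
    (K : functor A B) (V : functor H B) (u0 : g0 H ~> g0 A) (u1 : g1 H ~> g1 A) :
  discrete_fibration K -> f0 K ∘ u0 = f0 V ->
  gc A ∘ u1 = u0 ∘ gc H -> f1 K ∘ u1 = f1 V -> gd A ∘ u1 = u0 ∘ gd H ->
  exists U : functor H A, f0 U = u0 /\ f1 U = u1.
Proof.
intros hK k0 c1 k1 d1; apply functor_intro; [exact d1|exact c1| |].
- apply (pb_ext hK).
  + rewrite comp_assoc, c1, <- comp_assoc, gc_e, comp_idr, comp_assoc, gc_e.
    now rewrite comp_idl.
  + rewrite comp_assoc, k1, f_e, (comp_assoc (f1 K)), f_e, <- comp_assoc.
    now rewrite k0.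
- intros W a b e.
  assert (ec : gc A ∘ (u1 ∘ a) = gd A ∘ (u1 ∘ b)).
  { now rewrite !comp_assoc, c1, d1, <- !comp_assoc, e. }
  apply (pb_ext hK).
  + rewrite c_mul, !comp_assoc, c1, <- !comp_assoc, c_mul by assumption.
    reflexivity.
  + rewrite f_mul, !comp_assoc, k1, f_mul by assumption; reflexivity.
Qed.

(** * Contravariant actions of a groupoid and their groupoids of elements *)

Section Action.
Variables (C : category) (G : groupoid C) (Q : C) (q : Q ~> g0 G).
Variables (T : C) (t1 : T ~> Q) (t2 : T ~> g1 G) (act : T ~> Q).
Hypothesis hT : is_pullback q (gc G) t1 t2.
Hypothesis act_over : q ∘ act = gd G ∘ t2.
Hypothesis act_unit : forall W (t : W ~> T),
  t2 ∘ t = unit_at (q ∘ (t1 ∘ t)) -> act ∘ t = t1 ∘ t.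
(** Here [t'] is [(a, g)], [t] is [(act (a, g), g')] and [t''] is [(a, g' followed by g)]:
    restricting in two steps is restricting along the composite. *)
Hypothesis act_mul : forall W (t t' t'' : W ~> T),
  t1 ∘ t = act ∘ t' -> t1 ∘ t'' = t1 ∘ t' -> t2 ∘ t'' = mul (t2 ∘ t) (t2 ∘ t') ->
  act ∘ t'' = act ∘ t.
Variables (T2 : C) (r1 r2 : T2 ~> T).
Hypothesis hT2 : is_pullback t1 act r1 r2.

Let composable_t W (t t' : W ~> T) :
  t1 ∘ t = act ∘ t' -> gc G ∘ (t2 ∘ t) = gd G ∘ (t2 ∘ t').
Proof.
intros e; rewrite <- (pb_square hT), e; apply comp_pre2, act_over.
Qed.

Let composable_r W (w : W ~> T2) :
  gc G ∘ (t2 ∘ (r1 ∘ w)) = gd G ∘ (t2 ∘ (r2 ∘ w)).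
Proof. apply composable_t, (pb_square hT2). Qed.

Lemma action_e_square : q ∘ idm Q = gc G ∘ unit_at q.
Proof. now rewrite c_unit, comp_idr. Qed.

Lemma action_i_square : q ∘ act = gc G ∘ inv_at t2.
Proof. now rewrite c_inv. Qed.

Lemma action_m_square : q ∘ (t1 ∘ r2) = gc G ∘ mul (t2 ∘ r1) (t2 ∘ r2).
Proof.
rewrite c_mul; [apply (pb_square hT)|apply composable_t, hT2].
Qed.

Definition action_e : Q ~> T := pb_pair hT action_e_square.
Definition action_i : T ~> T := pb_pair hT action_i_square.
Definition action_m : T2 ~> T := pb_pair hT action_m_square.

Lemma action_e1 W (w : W ~> Q) : t1 ∘ (action_e ∘ w) = w.
Proof. unfold action_e; now rewrite comp_assoc, pb_pair1, comp_idl. Qed.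

Lemma action_e2 W (w : W ~> Q) : t2 ∘ (action_e ∘ w) = unit_at (q ∘ w).
Proof. unfold action_e; now rewrite comp_assoc, pb_pair2, unit_comp. Qed.

Lemma action_m1 W (w : W ~> T2) : t1 ∘ (action_m ∘ w) = t1 ∘ (r2 ∘ w).
Proof. unfold action_m; now rewrite comp_assoc, pb_pair1, comp_assoc. Qed.

Lemma action_m2 W (w : W ~> T2) :
  t2 ∘ (action_m ∘ w) = mul (t2 ∘ (r1 ∘ w)) (t2 ∘ (r2 ∘ w)).
Proof.
unfold action_m; rewrite comp_assoc, pb_pair2, mul_comp.
- now rewrite !comp_assoc.
- apply composable_t, hT2.
Qed.

Lemma action_d_e : act ∘ action_e = idm Q.
Proof.
rewrite <- (comp_idr action_e), act_unit; rewrite action_e1; [easy|].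
apply action_e2.
Qed.

Lemma action_c_e : t1 ∘ action_e = idm Q.
Proof. apply pb_pair1. Qed.

Lemma action_d_m : act ∘ action_m = act ∘ r1.
Proof.
apply (act_mul (t' := r2)); [apply hT2|apply pb_pair1|apply pb_pair2].
Qed.

Lemma action_c_m : t1 ∘ action_m = t1 ∘ r2.
Proof. apply pb_pair1. Qed.

Lemma action_m_unitl (u : T ~> T2) :
  r1 ∘ u = action_e ∘ act -> r2 ∘ u = idm T -> action_m ∘ u = idm T.
Proof.
intros u1 u2; apply (pb_ext hT).
- now rewrite action_m1, u2.
- rewrite action_m2, u1, u2, action_e2, comp_idr; now apply mul_unit_l.
Qed.

Lemma action_m_unitr (u : T ~> T2) :
  r1 ∘ u = idm T -> r2 ∘ u = action_e ∘ t1 -> action_m ∘ u = idm T.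
Proof.
intros u1 u2; apply (pb_ext hT).
- now rewrite action_m1, u2, action_e1, comp_idr.
- rewrite action_m2, u1, u2, action_e2, comp_idr; apply mul_unit_r, hT.
Qed.

Lemma action_m_assoc (W : C) (xy yz xy_z x_yz : W ~> T2) :
  r2 ∘ xy = r1 ∘ yz ->
  r1 ∘ xy_z = action_m ∘ xy -> r2 ∘ xy_z = r2 ∘ yz ->
  r1 ∘ x_yz = r1 ∘ xy -> r2 ∘ x_yz = action_m ∘ yz ->
  action_m ∘ xy_z = action_m ∘ x_yz.
Proof.
intros e e1 e2 e3 e4; apply (pb_ext hT).
- now rewrite !action_m1, e2, e4, action_m1.
- rewrite !action_m2, e1, e2, e3, e4, !action_m2, <- e, mul_assoc; [easy| |].
  + apply composable_r.
  + rewrite e; apply composable_r.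
Qed.

(** Restricting along [g] and then along its inverse is restricting along a unit; [w] is the
    composable pair of the inverse arrow and the arrow itself. *)
Lemma action_d_i : act ∘ action_i = t1.
Proof.
destruct (pb_lift hT2 (u := action_i) (v := idm T)) as [w [w1 w2]].
{ rewrite comp_idr; apply pb_pair1. }
rewrite <- w1, comp_assoc, <- action_d_m, <- comp_assoc, act_unit.
- now rewrite action_m1, w2, comp_idr.
- rewrite action_m2, action_m1, w1, w2, comp_idr, comp_idr, (proj1 hT).
  rewrite <- mul_inv_l; f_equal; apply pb_pair2.
Qed.

Lemma action_c_i : t1 ∘ action_i = act.
Proof. apply pb_pair1. Qed.

Lemma action_m_invr (u : T ~> T2) :
  r1 ∘ u = idm T -> r2 ∘ u = action_i -> action_m ∘ u = action_e ∘ act.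
Proof.
intros u1 u2; apply (pb_ext hT).
- now rewrite action_m1, u2, action_e1, action_c_i.
- rewrite action_m2, u1, u2, action_e2, comp_idr, act_over, <- mul_inv_r.
  f_equal; apply pb_pair2.
Qed.

Lemma action_m_invl (u : T ~> T2) :
  r1 ∘ u = action_i -> r2 ∘ u = idm T -> action_m ∘ u = action_e ∘ t1.
Proof.
intros u1 u2; apply (pb_ext hT).
- now rewrite action_m1, u2, action_e1, comp_idr.
- rewrite action_m2, u1, u2, action_e2, comp_idr, (proj1 hT), <- mul_inv_l.
  f_equal; apply pb_pair2.
Qed.

(** The arrow [(a, g)] of [T] goes from [act (a, g)], "[a] restricted along
    [g]", to [a]. *)
Definition action_groupoid : groupoid C :=
  Groupoid hT2 action_d_e action_c_e action_d_m action_c_m action_m_unitl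
    action_m_unitr action_m_assoc action_d_i action_c_i action_m_invr
    action_m_invl.

(** The codomain map of the action groupoid is [t1], so the discrete fibration condition is
    literally [hT]. *)
Lemma action_projection :
  exists K : functor action_groupoid G,
    discrete_fibration K /\ f0 K = q /\ f1 K = t2.
Proof.
destruct (@functor_intro _ action_groupoid G q t2) as [K [K0 K1]].
- symmetry; exact act_over.
- symmetry; apply hT.
- apply pb_pair2.
- intros W a b e.
  destruct (@composable _ action_groupoid _ _ _ e) as [z [z1 [z2 ->]]].
  cbn; rewrite action_m2; cbn in z1, z2; now rewrite z1, z2.
- exists K; unfold discrete_fibration; rewrite K0, K1; now repeat split; try apply hT.
Qed.

End Action.

(** * Connected components in a Barr-exact category *)

Section Components.
Variables (C : category) (hC : barr_exact C).
Variables (H : groupoid C) (S : support H) (Q : components S).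

Lemma pi0_q_regular_epi : regular_epi (pi0_q Q).
Proof. exists (sob S), (sr1 S), (sr2 S); apply pi0_q_coequalizer. Qed.

Lemma pi0_q_arrow W (h : W ~> g1 H) :
  pi0_q Q ∘ (gd H ∘ h) = pi0_q Q ∘ (gc H ∘ h).
Proof.
rewrite <- (sr1_sigma S), <- (sr2_sigma S), !comp_assoc.
now rewrite (proj1 (pi0_q_coequalizer Q)).
Qed.

(** Exactness makes the support the kernel pair of some [f]. Since [f] factors through the
    coequalizer, elements identified by [pi0_q Q] are identified by [f]. *)
Lemma pi0_q_kernel_pair W (x x' : W ~> g0 H) : pi0_q Q ∘ x = pi0_q Q ∘ x' ->
  exists s : W ~> sob S, sr1 S ∘ s = x /\ sr2 S ∘ s = x'.
Proof.
intros e.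
destruct (proj2 hC _ _ _ _ (support_equivalence S (proj1 hC))) as [Y [f hf]].
destruct (proj2 (pi0_q_coequalizer Q) Y f (proj1 hf)) as [h [hh _]].
apply (pb_lift hf); now rewrite <- hh, <- !comp_assoc, e.
Qed.

(** The kernel pair gives an element of the support, which lifts locally along [sigma S] to an
    actual arrow. *)
Lemma pi0_q_connected W (x x' : W ~> g0 H) : pi0_q Q ∘ x = pi0_q Q ∘ x' ->
  exists W' (e : W' ~> W) (h : W' ~> g1 H),
    regular_epi e /\ gd H ∘ h = x ∘ e /\ gc H ∘ h = x' ∘ e.
Proof.
intros e; destruct (pi0_q_kernel_pair e) as [s [<- <-]].
destruct (local_section (proj1 hC) s (sigma_regular_epi S)) as [W' [c [h [hc hh]]]].
exists W', c, h; split; [exact hc|].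
now rewrite <- (sr1_sigma S), <- (sr2_sigma S), <- !comp_assoc, hh.
Qed.

End Components.

(** * Finality as local essential surjectivity and fullness *)

Section Final.
Variables (C : category) (hC : barr_exact C).
Variables (H G : groupoid C) (F : functor H G).

Definition locally_surjective : Prop :=
  forall W (y : W ~> g0 G),
    exists W' (e : W' ~> W) (x : W' ~> g0 H) (g : W' ~> g1 G),
      regular_epi e /\ gd G ∘ g = y ∘ e /\ gc G ∘ g = f0 F ∘ x.

Definition locally_full : Prop :=
  forall W (x x' : W ~> g0 H) (g : W ~> g1 G),
    gd G ∘ g = f0 F ∘ x -> gc G ∘ g = f0 F ∘ x' ->
    exists W' (e : W' ~> W) (h : W' ~> g1 H),
      regular_epi e /\ gd H ∘ h = x ∘ e /\ gc H ∘ h = x' ∘ e /\ f1 F ∘ h = g ∘ e.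

(** * Construction of the diagonal against a discrete fibration *)

Section Lift.
Hypotheses (hs : locally_surjective) (hf : locally_full).
Variables (A B : groupoid C) (K : functor A B) (hK : discrete_fibration K).
Variables (U : functor H A) (V : functor G B).
Hypotheses (KU0 : f0 K ∘ f0 U = f0 V ∘ f0 F) (KU1 : f1 K ∘ f1 U = f1 V ∘ f1 F).

Lemma locally_full_surjective_lift :
  exists D : functor G A,
    (f0 D ∘ f0 F = f0 U /\ f1 D ∘ f1 F = f1 U) /\
    (f0 K ∘ f0 D = f0 V /\ f1 K ∘ f1 D = f1 V) /\
    forall D' : functor G A,
      f0 D' ∘ f0 F = f0 U -> f1 D' ∘ f1 F = f1 U ->
      f0 K ∘ f0 D' = f0 V -> f1 K ∘ f1 D' = f1 V ->
      f0 D = f0 D' /\ f1 D = f1 D'.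
Proof.
unfold discrete_fibration in hK.
(* [X] is the comma object of pairs [(x, g : y -> f0 x)]; local surjectivity makes the projection to
   [y] a regular epimorphism. *)
destruct (proj2 (proj1 (proj1 hC)) _ _ _ (gc G) (f0 F)) as [X [xg [xh hX]]].
assert (rX : regular_epi (gd G ∘ xg)).
{ destruct (hs (idm (g0 G))) as [W [e [x [g [he [h1 h2]]]]]].
  destruct (pb_lift hX h2) as [w [w1 w2]].
  apply (regular_epi_local (proj1 hC) (x := w) he).
  now rewrite <- comp_assoc, w1, h1, comp_idl. }
(* [al] is the lift of [V g] along [K] with codomain [U x]; its domain is the value intended for
   [D0 y]. *)
destruct (@pb_lift _ _ _ _ _ _ _ _ _ hK _ (f0 U ∘ xh) (f1 V ∘ xg)) as [al [al1 al2]].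
{ now rewrite f_c_at, (proj1 hX), !comp_assoc, KU0. }
assert (al1' : forall W (w : W ~> X), gc A ∘ (al ∘ w) = f0 U ∘ (xh ∘ w)).
{ intros; now rewrite !comp_assoc, al1. }
assert (al2' : forall W (w : W ~> X), f1 K ∘ (al ∘ w) = f1 V ∘ (xg ∘ w)).
{ intros; now rewrite !comp_assoc, al2. }
assert (D0x : exists D0 : g0 G ~> g0 A, D0 ∘ (gd G ∘ xg) = gd A ∘ al).
{ apply regular_epi_descent; [exact rX|]; intros W a b; rewrite <- !comp_assoc; intros e.
  (* Two arrows out of the same [y] differ by an arrow [f0 x -> f0 x'], locally of the form
     [f1 F ∘ h]. The lifts then differ by [U h], so their domains agree. *)
  destruct (@hf _ (xh ∘ a) (xh ∘ b) (mul (inv_at (xg ∘ a)) (xg ∘ b)))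
    as [W' [c [h [hc [h1 [h2 h3]]]]]].
  { rewrite d_mul, d_inv by now rewrite c_inv. apply (pb_square hX). }
  { rewrite c_mul by now rewrite c_inv. apply (pb_square hX). }
  apply (regular_epi_epi hc).
  assert (e' : gd G ∘ (xg ∘ (a ∘ c)) = gd G ∘ (xg ∘ (b ∘ c))).
  { apply (f_equal (fun t => t ∘ c)) in e; now rewrite <- !comp_assoc in e. }
  assert (ec : gc A ∘ (al ∘ (a ∘ c)) = gd A ∘ (f1 U ∘ h)).
  { rewrite al1', f_d_at, h1; now rewrite !comp_assoc. }
  assert (eb : al ∘ (b ∘ c) = mul (al ∘ (a ∘ c)) (f1 U ∘ h)).
  { apply (pb_ext hK).
    - rewrite c_mul, f_c_at, al1', h2 by exact ec; now rewrite !comp_assoc.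
    - rewrite f_mul, !al2', (comp_assoc (f1 K)), KU1 by exact ec.
      rewrite <- comp_assoc, h3, mul_comp by now rewrite c_inv.
      rewrite inv_comp, <- f_mul, <- !comp_assoc, mul_cancel_inv_l; try easy.
      rewrite d_mul; rewrite ?d_inv, ?c_inv, <- !comp_assoc; easy. }
  rewrite <- !comp_assoc, eb, d_mul by exact ec; reflexivity. }
destruct D0x as [D0 hD0].
assert (hD0' : forall W (w : W ~> X), D0 ∘ (gd G ∘ (xg ∘ w)) = gd A ∘ (al ∘ w)).
{ intros; rewrite !comp_assoc, <- hD0; now rewrite !comp_assoc. }
assert (kD0 : f0 K ∘ D0 = f0 V).
{ apply (regular_epi_epi rX).
  now rewrite <- comp_assoc, hD0, <- f_d_at, al2, f_d_at. }
(* The arrow part is forced: the lift of [V g] ending at [D0] of the codomain of [g]. *)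
destruct (@pb_lift _ _ _ _ _ _ _ _ _ hK _ (D0 ∘ gc G) (f1 V)) as [D1 [c1 k1]].
{ now rewrite comp_assoc, kD0, f_c. }
assert (c1' : forall W (g : W ~> g1 G), gc A ∘ (D1 ∘ g) = D0 ∘ (gc G ∘ g)).
{ intros; now apply comp_pre2. }
assert (k1' : forall W (g : W ~> g1 G), f1 K ∘ (D1 ∘ g) = f1 V ∘ g).
{ intros; now apply comp_pre. }
assert (d1 : gd A ∘ D1 = D0 ∘ gd G).
(* Locally the codomain of the arrow [e] has a comma arrow [w] out of it. Then [w'], that is [e]
   followed by [w], starts at the domain of [e], and its lift is [D1 ∘ e] followed by the lift of
   [w]. *)
{ destruct (local_section (proj1 hC) (gc G) rX) as [W [e [w [he hw]]]].
  rewrite <- comp_assoc in hw; symmetry in hw.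
  apply (regular_epi_epi he); rewrite <- !comp_assoc.
  destruct (@pb_lift _ _ _ _ _ _ _ _ _ hX _ (mul e (xg ∘ w)) (xh ∘ w)) as [w' [w1 w2]].
  { rewrite c_mul by exact hw; apply (pb_square hX). }
  assert (ec : gc A ∘ (D1 ∘ e) = gd A ∘ (al ∘ w)).
  { now rewrite c1', hw, hD0'. }
  assert (eq : al ∘ w' = mul (D1 ∘ e) (al ∘ w)).
  { apply (pb_ext hK).
    - now rewrite c_mul, !al1', w2 by exact ec.
    - now rewrite f_mul, k1', !al2', w1, f_mul by first [exact ec|exact hw]. }
  rewrite <- (d_mul ec), <- eq, <- hD0', w1, d_mul by exact hw; reflexivity. }
assert (d1' : forall W (g : W ~> g1 G), gd A ∘ (D1 ∘ g) = D0 ∘ (gd G ∘ g)).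
{ intros; now apply comp_pre2. }
destruct (discrete_fibration_functor hK kD0 c1 k1 d1) as [D [E0 E1]].
assert (F0 : D0 ∘ f0 F = f0 U).
(* At [f0 x] the identity may be chosen as comma arrow; it lifts to the identity of [U x]. *)
{ destruct (@pb_lift _ _ _ _ _ _ _ _ _ hX _ (unit_at (f0 F)) (idm _)) as [w [w1 w2]].
  { now rewrite c_unit, comp_idr. }
  assert (ea : al ∘ w = unit_at (f0 U)).
  { apply (pb_ext hK).
    - now rewrite al1', w2, comp_idr, c_unit.
    - rewrite al2', w1, !f_unit; now f_equal. }
  rewrite <- (d_unit (f0 F)), <- w1, hD0', ea; apply d_unit. }
exists D; rewrite E0, E1; split; [split; [exact F0|]|split; [now split|]].
- apply (pb_ext hK).
  + now rewrite c1', !f_c, comp_assoc, F0.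
  + now rewrite k1', KU1.
- intros D' a0 a1 b0 b1.
  (* For any other diagonal [D'], the arrow [D' g] also lifts [V g] and ends at [U x], so it is [al]
     and has the same domain. *)
  assert (D00 : D0 = f0 D').
  { apply (regular_epi_epi rX).
    rewrite hD0, <- f_d_at; f_equal; apply (pb_ext hK).
    - now rewrite al1, f_c_at, (proj1 hX), comp_assoc, a0.
    - now rewrite al2, comp_assoc, b1. }
  split; [exact D00|].
  apply (pb_ext hK).
  + now rewrite c1, f_c, D00.
  + now rewrite k1, b1.
Qed.

End Lift.

Lemma final_of_locally_full_surjective :
  locally_surjective -> locally_full -> final F.
Proof.
intros hs hf A B K hK U V e.
pose proof (f_equal (fun L : functor H B => f0 L) e) as e0.
pose proof (f_equal (fun L : functor H B => f1 L) e) as e1.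
destruct (locally_full_surjective_lift hs hf hK e0 e1)
  as [D [[a0 a1] [[b0 b1] u]]].
exists D; split; [split; now apply functor_ext|].
intros D' [e2 e3].
assert (f0 D = f0 D' /\ f1 D = f1 D') as [u0 u1].
{ apply u; first [rewrite <- e2|rewrite <- e3]; reflexivity. }
now apply functor_ext.
Qed.

(** * Components of the comma object and the test fibration *)

Section CommaQuotient.
Variables (X : C) (xg : X ~> g1 G) (xh : X ~> g0 H).
Hypothesis hX : is_pullback (gc G) (f0 F) xg xh.

(** The classes are the connected components of the groupoid of the action of
    [H] on the comma object [X]. *)
Lemma comma_quotient :
  exists (Q : C) (q : X ~> Q),
    regular_epi q /\
    (forall W (w w' : W ~> X) (h : W ~> g1 H),
      gd H ∘ h = xh ∘ w -> gc H ∘ h = xh ∘ w' ->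
      mul (xg ∘ w) (f1 F ∘ h) = xg ∘ w' -> q ∘ w = q ∘ w') /\
    forall W (w w' : W ~> X), q ∘ w = q ∘ w' ->
      exists W' (e : W' ~> W) (h : W' ~> g1 H),
        regular_epi e /\ gd H ∘ h = xh ∘ (w ∘ e) /\ gc H ∘ h = xh ∘ (w' ∘ e) /\
        mul (xg ∘ (w ∘ e)) (f1 F ∘ h) = xg ∘ (w' ∘ e).
Proof.
pose proof (proj2 (proj1 (proj1 hC))) as pb.
destruct (pb _ _ _ xh (gc H)) as [T [t1 [t2 hT]]].
assert (ci : forall W (t : W ~> T),
  gc G ∘ (xg ∘ (t1 ∘ t)) = gd G ∘ inv_at (f1 F ∘ (t2 ∘ t))).
{ intros; now rewrite d_inv, f_c_at, <- (pb_square hT), (pb_square hX). }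
(* An arrow [h : x -> x'] sends [(x', g)] to [(x, g followed by the inverse of f1 h)]. *)
destruct (pb_lift hX (u := mul (xg ∘ t1) (inv_at (f1 F ∘ t2))) (v := gd H ∘ t2))
  as [act [act1 act2]].
{ pose proof (ci _ (idm T)) as ci1; rewrite !comp_idr in ci1.
  now rewrite c_mul, c_inv, f_d_at. }
assert (act1' : forall W (t : W ~> T),
  xg ∘ (act ∘ t) = mul (xg ∘ (t1 ∘ t)) (inv_at (f1 F ∘ (t2 ∘ t)))).
{ intros W t; pose proof (ci _ (idm T)) as ci1; rewrite !comp_idr in ci1.
  now rewrite comp_assoc, act1, mul_comp, inv_comp, <- !comp_assoc. }
assert (act2' : forall W (t : W ~> T), xh ∘ (act ∘ t) = gd H ∘ (t2 ∘ t)).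
{ intros; now rewrite !comp_assoc, act2. }
destruct (pb _ _ _ t1 act) as [T2 [r1 [r2 hT2]]].
assert (au : forall W (t : W ~> T),
  t2 ∘ t = unit_at (xh ∘ (t1 ∘ t)) -> act ∘ t = t1 ∘ t).
{ intros W t e; apply (pb_ext hX).
  - rewrite act1', e, f_unit, inv_unit; apply mul_unit_r.
    symmetry; apply (pb_square hX).
  - now rewrite act2', e, d_unit. }
assert (am : forall W (t t' t'' : W ~> T),
  t1 ∘ t = act ∘ t' -> t1 ∘ t'' = t1 ∘ t' -> t2 ∘ t'' = mul (t2 ∘ t) (t2 ∘ t') ->
  act ∘ t'' = act ∘ t).
{ intros W t t' t'' e1 e2 e3.
  assert (e : gc H ∘ (t2 ∘ t) = gd H ∘ (t2 ∘ t')).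
  { now rewrite <- (pb_square hT), e1, act2'. }
  apply (pb_ext hX).
  - rewrite !act1', e1, e2, e3, act1', f_mul, inv_mul, mul_assoc; auto.
    + rewrite c_inv, d_inv, f_d_at, f_c_at; now f_equal.
    + rewrite f_d_at, f_c_at; now f_equal.
  - now rewrite !act2', e3, d_mul. }
pose (M := action_groupoid hT act2 au am hT2).
destruct (support_exists M (proj1 hC)) as [S].
destruct (components_exist S hC) as [Q].
exists (pi0 Q), (pi0_q Q); split; [exact (pi0_q_regular_epi Q)|split].
- intros W w w' h h1 h2 h3.
  (* The arrow [t = (w', h)] of [M] goes from [w] to [w']. *)
  destruct (pb_lift hT (eq_sym h2)) as [t [e1 e2]].
  rewrite <- e1; refine (eq_trans _ (pi0_q_arrow Q (t : W ~> g1 M))).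
  f_equal; apply (pb_ext hX); cbn.
  + rewrite act1', e1, e2, <- h3; symmetry; apply mul_cancel_r.
    now rewrite f_d_at, h1, (pb_square hX).
  + now rewrite act2', e2.
- intros W w w' e.
  destruct (pi0_q_connected hC e) as [W' [c [t [hc [ed ec]]]]]; cbn in t, ed, ec.
  exists W', c, (t2 ∘ t); rewrite <- act2', <- (pb_square hT), ed, ec.
  repeat split; [exact hc|].
  rewrite <- ed, <- ec, act1'; apply mul_cancel_inv_r.
  now rewrite (pb_square hX), (pb_square hT), f_c_at.
Qed.

End CommaQuotient.

(** Test [F] against the second factor [K] of its comprehensive factorization:
    the objects of [E] over [y] are the connected components of arrows
    [y -> f0 x], and a section of [K] that extends [U] turns these components
    into the required data. *)
Lemma final_locally_full_surjective :
  final F -> locally_surjective /\ locally_full.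
Proof.
intros fin.
pose proof (proj2 (proj1 (proj1 hC))) as pb.
destruct (pb _ _ _ (gc G) (f0 F)) as [X [xg [xh hX]]].
destruct (comma_quotient hX) as [Q [q [rq [q_eq q_conn]]]].
(* [k] sends the class of [(x, g : y -> f0 x)] to [y]: moving along an arrow of [H] preserves the
   domain of [g]. *)
destruct (regular_epi_descent (f := gd G ∘ xg) rq) as [k hk].
{ intros W a b e; destruct (q_conn _ _ _ e) as [W' [c [h [hc [e1 [e2 e3]]]]]].
  apply (regular_epi_epi hc); rewrite <- !comp_assoc, <- e3, d_mul; [easy|].
  now rewrite f_d_at, e1, (pb_square hX). }
assert (hk' : forall W (w : W ~> X), k ∘ (q ∘ w) = gd G ∘ (xg ∘ w)).
{ intros; now apply comp_pre2. }
destruct (pb _ _ _ k (gc G)) as [T [t1 [t2 hT]]].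
(* Locally the class in an element of [T] has a representative, which is composable with the arrow
   in it. *)
assert (loc : forall W (t : W ~> T), exists W' (e : W' ~> W) (w : W' ~> X),
  regular_epi e /\ q ∘ w = t1 ∘ (t ∘ e) /\
  gc G ∘ (t2 ∘ (t ∘ e)) = gd G ∘ (xg ∘ w)).
{ intros W t; destruct (local_section (proj1 hC) (t1 ∘ t) rq) as [W' [e [w [he hw]]]].
  exists W', e, w; rewrite <- comp_assoc in hw; repeat split; [exact he|exact hw|].
  now rewrite <- hk', hw, (pb_square hT). }
assert (hact : exists act : T ~> Q, forall W (t : W ~> T) (w w' : W ~> X),
  q ∘ w = t1 ∘ t -> xg ∘ w' = mul (t2 ∘ t) (xg ∘ w) -> xh ∘ w' = xh ∘ w ->
  act ∘ t = q ∘ w').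
(* [G] acts by precomposition. This is defined on the object [T'] of representatives with a
   composable arrow and descends along [r], since precomposition commutes with moves along [H]. *)
{ destruct (pb _ _ _ (gd G ∘ xg) (gc G)) as [T' [s1 [s2 hT']]].
  assert (cs : gc G ∘ s2 = gd G ∘ (xg ∘ s1)).
  { now rewrite <- (proj1 hT'), comp_assoc. }
  destruct (pb_lift hT (u := q ∘ s1) (v := s2)) as [r [e1 e2]].
  { now rewrite hk', <- cs. }
  destruct (pb_lift hX (u := mul s2 (xg ∘ s1)) (v := xh ∘ s1)) as [phi [p1 p2]].
  { rewrite c_mul by exact cs; apply (pb_square hX). }
  assert (p1' : forall W (w : W ~> T'),
    xg ∘ (phi ∘ w) = mul (s2 ∘ w) (xg ∘ (s1 ∘ w))).
  { intros; now rewrite comp_assoc, p1, mul_comp, <- comp_assoc. }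
  assert (rr : regular_epi r).
  { destruct (loc _ (idm T)) as [W [e [w [he [h1 h2]]]]].
    rewrite comp_idl in h1, h2.
    destruct (pb_lift hT' (u := w) (v := t2 ∘ e)) as [w' [w1 w2]].
    { now rewrite <- comp_assoc. }
    apply (regular_epi_local (proj1 hC) (x := w') he), (pb_ext hT).
    - now rewrite comp_assoc, e1, <- comp_assoc, w1.
    - now rewrite comp_assoc, e2. }
  destruct (regular_epi_descent (f := q ∘ phi) rr) as [act hact].
  { intros W a b e.
    assert (ea : q ∘ (s1 ∘ a) = q ∘ (s1 ∘ b)).
    { now rewrite !comp_assoc, <- e1, <- !comp_assoc, e. }
    assert (eb : s2 ∘ a = s2 ∘ b).
    { now rewrite <- e2, <- !comp_assoc, e. }
    destruct (q_conn _ _ _ ea) as [W' [c [h [hc [h1 [h2 h3]]]]]].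
    apply (regular_epi_epi hc); rewrite <- !comp_assoc.
    rewrite <- !comp_assoc in h1, h2, h3.
    apply (q_eq _ _ _ h).
    - now rewrite h1, !comp_assoc, p2.
    - now rewrite h2, !comp_assoc, p2.
    - rewrite !p1', mul_assoc, h3, (comp_assoc s2), eb.
      + now rewrite <- !comp_assoc.
      + now rewrite (comp_pre2 _ cs), <- comp_assoc.
      + now rewrite f_d_at, h1, (pb_square hX). }
  exists act; intros W t w w' h1 h2 h3.
  destruct (pb_lift hT' (u := w) (v := t2 ∘ t)) as [t' [z1 z2]].
  { now rewrite <- (pb_square hT), <- h1, hk', comp_assoc. }
  assert (et : r ∘ t' = t).
  { apply (pb_ext hT); rewrite comp_assoc; [rewrite e1|now rewrite e2].
    now rewrite <- comp_assoc, z1. }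
  rewrite <- et, comp_assoc, hact, <- comp_assoc; f_equal.
  apply (pb_ext hX).
  - now rewrite p1', z1, z2.
  - now rewrite comp_assoc, p2, <- comp_assoc, z1. }
destruct hact as [act hact].
assert (ext : forall W (g : W ~> g1 G) (w : W ~> X),
  gc G ∘ g = gd G ∘ (xg ∘ w) ->
  exists w' : W ~> X, xg ∘ w' = mul g (xg ∘ w) /\ xh ∘ w' = xh ∘ w).
{ intros W g w e; apply (pb_lift hX).
  rewrite c_mul by exact e; apply (pb_square hX). }
assert (act_over : k ∘ act = gd G ∘ t2).
{ destruct (loc _ (idm T)) as [W [e [w [he [h1 h2]]]]].
  rewrite comp_idl in h1, h2.
  destruct (ext _ _ _ h2) as [w' [w1 w2]].
  apply (regular_epi_epi he); rewrite <- !comp_assoc.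
  now rewrite (hact _ _ _ _ h1 w1 w2), hk', w1, d_mul. }
assert (act_unit : forall W (t : W ~> T),
  t2 ∘ t = unit_at (k ∘ (t1 ∘ t)) -> act ∘ t = t1 ∘ t).
{ intros W t et; destruct (loc _ t) as [W' [e [w [he [h1 h2]]]]].
  apply (regular_epi_epi he); rewrite <- !comp_assoc, <- h1.
  apply (hact _ _ w); [exact h1| |reflexivity].
  rewrite comp_assoc, et, unit_comp, <- !comp_assoc, <- h1, hk'.
  symmetry; now apply mul_unit_l. }
assert (act_mul : forall W (t t' t'' : W ~> T),
  t1 ∘ t = act ∘ t' -> t1 ∘ t'' = t1 ∘ t' -> t2 ∘ t'' = mul (t2 ∘ t) (t2 ∘ t') ->
  act ∘ t'' = act ∘ t).
{ intros W t t' t'' e1 e2 e3; destruct (loc _ t') as [W' [e [w [he [h1 h2]]]]].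
  destruct (ext _ _ _ h2) as [w1 [a1 b1]].
  assert (h3 : q ∘ w1 = t1 ∘ (t ∘ e)).
  { rewrite <- (hact _ _ _ _ h1 a1 b1), !comp_assoc; now f_equal. }
  assert (h4 : gc G ∘ (t2 ∘ (t ∘ e)) = gd G ∘ (xg ∘ w1)).
  { now rewrite <- (pb_square hT), <- h3, hk'. }
  assert (h5 : gc G ∘ (t2 ∘ (t ∘ e)) = gd G ∘ (t2 ∘ (t' ∘ e))).
  { now rewrite h4, a1, d_mul. }
  destruct (ext _ _ _ h4) as [w2 [a2 b2]].
  apply (regular_epi_epi he); rewrite <- !comp_assoc.
  rewrite (hact _ _ _ _ h3 a2 b2).
  apply (hact _ _ w); [| |now rewrite b2].
  - rewrite h1, !comp_assoc; now f_equal.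
  - rewrite a2, a1, (comp_assoc t2 t''), e3, mul_comp, <- !comp_assoc.
    + symmetry; now apply mul_assoc.
    + rewrite <- (pb_square hT), e1; now apply comp_pre2. }
destruct (pb _ _ _ t1 act) as [T2 [r1 [r2 hT2]]].
destruct (action_projection hT act_over act_unit act_mul hT2) as [K [hK [K0 K1]]].
(* [eta] sends [x] to [(x, id)]; [q ∘ eta] is the object part of the lift of [F]. *)
destruct (pb_lift hX (u := unit_at (f0 F)) (v := idm (g0 H))) as [eta [eta1 eta2]].
{ now rewrite c_unit, comp_idr. }
assert (eta1' : forall W (x : W ~> g0 H), xg ∘ (eta ∘ x) = unit_at (f0 F ∘ x)).
{ intros; now rewrite comp_assoc, eta1, unit_comp. }
assert (eta2' : forall W (x : W ~> g0 H), xh ∘ (eta ∘ x) = x).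
{ intros; now rewrite comp_assoc, eta2, comp_idl. }
assert (k_eta : forall W (x : W ~> g0 H), k ∘ (q ∘ (eta ∘ x)) = f0 F ∘ x).
{ intros; now rewrite hk', eta1', d_unit. }
assert (act_eta : forall W (t : W ~> T) (x : W ~> g0 H) (w : W ~> X),
  t1 ∘ t = q ∘ (eta ∘ x) -> xg ∘ w = t2 ∘ t -> xh ∘ w = x -> act ∘ t = q ∘ w).
{ intros W t x w e1 e2 e3; apply (hact _ _ (eta ∘ x)); [now symmetry| |].
  - rewrite eta1', e2; symmetry; apply mul_unit_r.
    now rewrite <- (pb_square hT), e1, k_eta.
  - now rewrite eta2'. }
destruct (pb_lift hT (u := q ∘ (eta ∘ gc H)) (v := f1 F)) as [u1 [e1 e2]].
{ now rewrite k_eta, f_c. }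
destruct (@discrete_fibration_functor _ H _ _ K F (q ∘ eta) u1 hK) as [U [U0 U1]].
{ rewrite K0; pose proof (k_eta _ (idm _)) as h; now rewrite !comp_idr in h. }
{ now rewrite <- comp_assoc. }
{ now rewrite K1. }
(* For [h : x -> x'], restricting the class of [(x', id)] along [f1 h] gives that of [(x', f1 h)],
   which [h] connects to [(x, id)]. *)
{ destruct (pb_lift hX (u := f1 F) (v := gc H)) as [w [w1 w2]]; [apply f_c|].
  cbn; rewrite (act_eta _ u1 (gc H) w) by (rewrite ?w1; auto).
  rewrite <- comp_assoc; symmetry; apply (q_eq _ _ _ (idm _)).
  - now rewrite comp_idr, eta2'.
  - now rewrite comp_idr, w2.
  - rewrite eta1', comp_idr, w1; apply mul_unit_l; symmetry; apply f_d. }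
(* Orthogonality for the square [K U = id F] gives a section [D] of [K] extending [U]. *)
destruct (fin _ _ K hK U (functor_id G)) as [D [[DF KD] _]].
{ apply functor_ext; cbn; rewrite comp_idl.
  - rewrite K0, U0; pose proof (k_eta _ (idm _)) as h; now rewrite !comp_idr in h.
  - now rewrite K1, U1. }
pose proof (f_equal (fun L : functor H _ => f0 L) DF) as DF0.
pose proof (f_equal (fun L : functor G G => f0 L) KD) as KD0.
pose proof (f_equal (fun L : functor G G => f1 L) KD) as KD1.
cbn in DF0, KD0, KD1; rewrite K0 in KD0; rewrite K1 in KD1; rewrite U0 in DF0.
pose proof (f_d_at D) as dD; pose proof (f_c_at D) as cD.
cbn in D, dD, cD; set (D0 := f0 D) in *; set (D1 := f1 D) in *; cbn in D0, D1.
split.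
- intros W y; destruct (local_section (proj1 hC) (D0 ∘ y) rq) as [W' [e [w [he hw]]]].
  exists W', e, (xh ∘ w), (xg ∘ w); repeat split; [exact he| |apply (pb_square hX)].
  now rewrite <- hk', hw, !comp_assoc, KD0, comp_idl.
- intros W x x' g hd hc.
  destruct (pb_lift hX (u := g) (v := x')) as [w [w1 w2]]; [exact hc|].
  (* The arrow [D g] ends at the class of [(x', id)], so its domain is the class of [(x', g)]; that
     domain is also [D (f0 x)], the class of [(x, id)]. *)
  assert (e : q ∘ (eta ∘ x) = q ∘ w).
  { rewrite comp_assoc, <- DF0, <- comp_assoc, <- hd.
    change (D0 ∘ (gd G ∘ g) = q ∘ w); rewrite <- dD.
    apply (act_eta _ _ x'); [| |exact w2].
    - rewrite cD, hc, !comp_assoc; now f_equal.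
    - now rewrite w1, comp_assoc, KD1, comp_idl. }
  destruct (q_conn _ _ _ e) as [W' [c [h [rc [h1 [h2 h3]]]]]].
  rewrite <- comp_assoc, eta2' in h1.
  exists W', c, h; repeat split; [exact rc|exact h1| |].
  + now rewrite h2, comp_assoc, w2.
  + rewrite <- comp_assoc, eta1', mul_unit_l in h3.
    * now rewrite h3, comp_assoc, w1.
    * now rewrite f_d_at, h1.
Qed.

End Final.

(** * The local conditions in terms of components and support *)

Section Components.
Variables (C : category) (hC : barr_exact C).
Variables (H G : groupoid C) (F : functor H G) (SH : support H) (SG : support G).
Variables (QH : components SH) (QG : components SG).
Variables (pi0F : pi0 QH ~> pi0 QG) (hpi0F : is_pi0_map F pi0F).

Let pi0F_q W (x : W ~> g0 H) :
  pi0F ∘ (pi0_q QH ∘ x) = pi0_q QG ∘ (f0 F ∘ x).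
Proof. now apply comp_pre2. Qed.

(** Local surjectivity makes [pi0F] a regular epimorphism. It is monic because representatives of
    two classes with equal images are joined, after [F], by a local arrow of [G], which lifts to
    [H]. *)
Lemma pi0_iso_of_locally_full_surjective :
  locally_surjective F -> locally_full F -> is_iso pi0F.
Proof.
intros hs hf; pose proof (proj1 hC) as hR.
apply (regular_epi_mono_iso hR).
- destruct (hs _ (idm _)) as [W [e [x [g [he [h1 h2]]]]]].
  apply (regular_epi_local hR (e := pi0_q QG ∘ e) (x := pi0_q QH ∘ x)).
  + apply (regular_epi_comp hR he), pi0_q_regular_epi.
  + rewrite comp_idl in h1; now rewrite pi0F_q, <- h2, <- h1, pi0_q_arrow.
- intros W u v huv.
  destruct (local_section hR u (pi0_q_regular_epi QH)) as [W1 [e1 [x [r1 hx]]]].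
  destruct (local_section hR (v ∘ e1) (pi0_q_regular_epi QH))
    as [W2 [e2 [x' [r2 hx']]]].
  destruct (@pi0_q_connected _ hC _ _ QG _ (f0 F ∘ (x ∘ e2)) (f0 F ∘ x'))
    as [W3 [e3 [g [r3 [h1 h2]]]]].
  { rewrite <- !pi0F_q, hx', (comp_assoc (pi0_q QH)), hx, !comp_assoc.
    now rewrite huv. }
  rewrite <- comp_assoc in h1, h2.
  destruct (hf _ _ _ _ h1 h2) as [W4 [e4 [h [r4 [k1 [k2 _]]]]]].
  apply (regular_epi_epi r1), (regular_epi_epi r2), (regular_epi_epi r3),
    (regular_epi_epi r4).
  rewrite <- hx, <- hx'; rewrite <- !comp_assoc in *.
  now rewrite <- k1, <- k2, pi0_q_arrow.
Qed.

(** A local representative [x] of the preimage of the class of [y] has [f0 x] in the component of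
    [y]. *)
Lemma locally_surjective_of_pi0_iso : is_iso pi0F -> locally_surjective F.
Proof.
intros [p [_ hp]] W y; pose proof (proj1 hC) as hR.
destruct (local_section hR (p ∘ (pi0_q QG ∘ y)) (pi0_q_regular_epi QH))
  as [W1 [e1 [x [r1 hx]]]].
destruct (@pi0_q_connected _ hC _ _ QG _ (y ∘ e1) (f0 F ∘ x))
  as [W2 [e2 [g [r2 [h1 h2]]]]].
{ now rewrite <- pi0F_q, hx, !comp_assoc, hp, comp_idl. }
exists W2, (e1 ∘ e2), (x ∘ e2), g; rewrite !comp_assoc.
split; [now apply regular_epi_comp|now split].
Qed.

Variables (SF : sob SH ~> sob SG) (hSF : is_support_map F SF).
Variables (P : C) (p1 : P ~> sob SH) (p2 : P ~> g1 G).
Hypothesis hP : is_pullback SF (sigma SG) p1 p2.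
Variable psiF : g1 H ~> P.
Hypotheses (hpsiF1 : p1 ∘ psiF = sigma SH) (hpsiF2 : p2 ∘ psiF = f1 F).

(** An element of [P] is a connected pair [(x, x')] with an arrow [g : f0 x -> f0 x']; fullness at
    the universal such element is a local section of [psiF]. *)
Lemma psi_regular_epi_of_locally_full : locally_full F -> regular_epi psiF.
Proof.
intros hf; destruct hSF as [_ [s1 s2]].
destruct (hf _ (sr1 SH ∘ p1) (sr2 SH ∘ p1) p2) as [W [e [h [he [h1 [h2 h3]]]]]].
{ rewrite <- (sr1_sigma SG), comp_assoc, <- s1, <- !comp_assoc; f_equal.
  symmetry; apply hP. }
{ rewrite <- (sr2_sigma SG), comp_assoc, <- s2, <- !comp_assoc; f_equal.
  symmetry; apply hP. }
apply (regular_epi_local (proj1 hC) (x := h) he), (pb_ext hP).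
- rewrite comp_assoc, hpsiF1; apply sr_jointly_monic.
  + now rewrite !comp_assoc, sr1_sigma.
  + now rewrite !comp_assoc, sr2_sigma.
- now rewrite comp_assoc, hpsiF2.
Qed.

(** Injectivity of [pi0F] puts [(x, x')] in the support of [H] as soon as an arrow
    [g : f0 x -> f0 x'] exists; the resulting element of [P] lifts locally along [psiF]. *)
Lemma locally_full_of_psi_regular_epi :
  is_iso pi0F -> regular_epi psiF -> locally_full F.
Proof.
intros [p [hp _]] hpsi W x x' g hd hc; destruct hSF as [_ [s1 s2]].
destruct (@pi0_q_kernel_pair _ hC _ _ QH _ x x') as [s [h1 h2]].
{ rewrite <- (comp_idl (pi0_q QH ∘ x)), <- (comp_idl (pi0_q QH ∘ x')), <- hp.
  rewrite <- !comp_assoc; f_equal; rewrite !pi0F_q, <- hd, <- hc.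
  apply pi0_q_arrow. }
destruct (pb_lift hP (u := s) (v := g)) as [w [w1 w2]].
{ apply sr_jointly_monic.
  - now rewrite !comp_assoc, s1, sr1_sigma, hd, <- comp_assoc, h1.
  - now rewrite !comp_assoc, s2, sr2_sigma, hc, <- comp_assoc, h2. }
destruct (local_section (proj1 hC) w hpsi) as [W' [e [h [he hh]]]].
assert (hs : sigma SH ∘ h = s ∘ e).
{ now rewrite <- hpsiF1, <- comp_assoc, hh, comp_assoc, w1. }
exists W', e, h; split; [exact he|].
rewrite <- (sr1_sigma SH), <- (sr2_sigma SH), <- !comp_assoc, hs, <- h1, <- h2.
rewrite <- hpsiF2, <- w2, <- !comp_assoc, hh; now repeat split.
Qed.

End Components.

Theorem corollary4p3 (C : category) (hC : barr_exact C)
    (H G : groupoid C) (F : functor H G)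
    (SH : support H) (SG : support G) (QH : components SH) (QG : components SG)
    (pi0F : pi0 QH ~> pi0 QG) (hpi0F : is_pi0_map F pi0F)
    (SF : sob SH ~> sob SG) (hSF : is_support_map F SF)
    (P : C) (p1 : P ~> sob SH) (p2 : P ~> g1 G)
    (hP : is_pullback SF (sigma SG) p1 p2)
    (psiF : g1 H ~> P)
    (hpsiF1 : p1 ∘ psiF = sigma SH) (hpsiF2 : p2 ∘ psiF = f1 F) :
  final F <-> is_iso pi0F /\ regular_epi psiF.
Proof.
split.
- intros fin; destruct (final_locally_full_surjective hC fin) as [hs hf]; split.
  + exact (pi0_iso_of_locally_full_surjective hC hpi0F hs hf).
  + exact (psi_regular_epi_of_locally_full hC hSF hP hpsiF1 hpsiF2 hf).
- intros [hi hpsi]; apply (final_of_locally_full_surjective hC).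
  + exact (locally_surjective_of_pi0_iso hC hpi0F hi).
  + exact (locally_full_of_psi_regular_epi hC hpi0F hSF hP hpsiF1 hpsiF2 hi hpsi).
Qed.
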